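(* Let $a\ge b\ge c\ge 1$ be integers with $b$ and $c$ both odd. If the spider $S(a,b,c)$ is $e$-positive, then $a=b+c$. *)

(* Defs.v *)
From HB Require Import structures.
From mathcomp Require Import all_boot all_order all_algebra.
From mathcomp Require Import mpoly.
Set Implicit Arguments. Unset Strict Implicit. Unset Printing Implicit Defensive.
Import Order.TTheory GRing.Theory Num.Theory.
Local Open Scope ring_scope.

(* Spider S(a,b,c): vertices 0..a+b+c, center 0; leg A = 1..a, leg B = a+1..a+b,
   leg C = a+b+1..a+b+c (each leg is a path, its first vertex joined to the
   center). Total number of vertices a+b+c+1. *)
Definition spider_step (a b c : nat) (i j : nat) : bool :=
  ((i == 0)%N && [|| (j == 1)%N && (0 < a)%N,
                     (j == a + 1)%N && (0 < b)%N |
                     (j == a + b + 1)%N && (0 < c)%N])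
  || [&& j == i.+1, (1 <= i)%N, i != a, i != (a + b)%N & (j <= a + b + c)%N].

Definition spider_adj (a b c : nat) : rel 'I_(a + b + c + 1) :=
  fun x y => spider_step a b c x y || spider_step a b c y x.

Definition proper_col (n N : nat) (adj : rel 'I_n) (k : {ffun 'I_n -> 'I_N}) : bool :=
  [forall x, forall y, adj x y ==> (k x != k y)].

Definition chrom_sym (n N : nat) (adj : rel 'I_n) : {mpoly int[N]} :=
  \sum_(k : {ffun 'I_n -> 'I_N} | proper_col adj k) \prod_(v : 'I_n) 'X_(k v).

Definition e_prod (N : nat) (l : seq nat) : {mpoly int[N]} :=
  \prod_(k <- l) mesym N int k.

(* l is a partition of n (as a multiset of positive parts, order irrelevant) *)
Definition is_part_of (n : nat) (l : seq nat) : bool :=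
  (sumn l == n) && all (fun k => 0 < k)%N l.

Definition e_positive_poly (N d : nat) (f : {mpoly int[N]}) : Prop :=
  exists s : seq (nat * seq nat),
    all (fun p => is_part_of d p.2) s /\
    f = \sum_(p <- s) (p.1)%:R * e_prod N p.2.

(* A graph on n vertices is e-positive iff X_G is e-positive; degree-n symmetric
   functions are faithfully represented in n variables. *)
Definition e_positive_graph (n : nat) (adj : rel 'I_n) : Prop :=
  e_positive_poly n (@chrom_sym n n adj).

Definition spider_e_positive (a b c : nat) : Prop :=
  @e_positive_graph (a + b + c + 1) (@spider_adj a b c).

(* Main.v *)
(** Adding up proper colorings leg by leg from the center gives the deletion
    identity [X_S(a,b,c+1) = X_S(a,b+1,c) + P_(c+1) P_(a+b+1) - P_(b+1) P_(a+c+1)],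
    so that [X_S(a,b,c)] is a polynomial in the path symmetric functions [P_m], and
    the [P_m] satisfy a recurrence with nonnegative coefficients in the [e_j]. As the
    [e_j] are algebraically independent, e-positivity survives any substitution of
    nonnegative values for them. If [a <> b + c], one such substitution fails:
    - [a] odd: at [e_2 = 1], all other [e_j = 0], the value is [-2];
    - [a] even, [a > b + c]: the coefficient of [e_3 e_2^k] is [1 - 2 (a - b - c)];
    - [a] even, [a < b + c]: at [e_k = e_(k+1) = 1] with [2 k + 1] the number of
      vertices, the value is [-2 k - 1]. *)
Require Import Defs.
From mathcomp Require Import all_boot all_order all_algebra.
From mathcomp Require Import mpoly zify ring.
Set Implicit Arguments. Unset Strict Implicit. Unset Printing Implicit Defensive.
Import Order.TTheory GRing.Theory Num.Theory.
Local Open Scope ring_scope.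

(** The deletion identity as a recursion moving leg C onto leg B; at [c = 0] a path remains. [P]
    stays abstract, to be instantiated with coloring sums, polynomials in the [e_j] and their
    values. *)
Fixpoint spider_form (A : comNzRingType) (P : nat -> A) (a b c : nat) : A :=
  if c is c'.+1 then
    spider_form P a b.+1 c' + P c'.+1 * P (a + b).+1 - P b.+1 * P (a + c').+1
  else P (a + b).+1.

Lemma spider_formS (A : comNzRingType) (P : nat -> A) a b c :
  spider_form P a b c.+1
    = spider_form P a b.+1 c + P c.+1 * P (a + b).+1 - P b.+1 * P (a + c).+1.
Proof. by []. Qed.

(** * Coloring sums of paths and spiders *)

Section LegSums.
Variables (A : comNzRingType) (N : nat) (x : 'I_N -> A).

Fixpoint leg_sum (m : nat) (i : 'I_N) : A :=
  if m is m'.+1 then \sum_(j | j != i) x j * leg_sum m' j else 1.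

Definition path_sum (m : nat) : A :=
  if m is m'.+1 then \sum_j x j * leg_sum m' j else 1.

Arguments leg_sum : simpl never.
Arguments path_sum : simpl never.

Lemma path_sumS m : path_sum m.+1 = \sum_j x j * leg_sum m j.
Proof. by []. Qed.

(** Dropping the constraint at the first vertex of the leg adds exactly the colorings that start
    with [i]. *)
Lemma leg_sumS m i : leg_sum m.+1 i = path_sum m.+1 - x i * leg_sum m i.
Proof. by rewrite /path_sum [in RHS](bigD1 i) //= addrAC subrr add0r. Qed.

Lemma two_legs_sum m k :
  \sum_i x i * (leg_sum m i * leg_sum k i) = path_sum (m + k).+1.
Proof.
elim: k m => [|k IHk] m.
  by rewrite addn0; apply: eq_bigr => i _; rewrite mulr1.
rewrite addnS -addSn -IHk; apply/eqP; rewrite -subr_eq0 -sumrB.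
rewrite (eq_bigr (fun i => path_sum k.+1 * (x i * leg_sum m i)
                         - path_sum m.+1 * (x i * leg_sum k i))) => [|i _].
  by rewrite sumrB -!mulr_sumr mulrC subrr.
by rewrite !leg_sumS; ring.
Qed.

(** By [leg_sumS], moving a vertex from leg C to leg B costs two terms with only two legs at the
    center; [two_legs_sum] makes these legs a path. *)
Lemma three_legs_sum a b c :
  \sum_i x i * (leg_sum a i * leg_sum b i * leg_sum c i)
    = spider_form path_sum a b c.
Proof.
elim: c b => [|c IHc] b.
  by rewrite -[RHS]two_legs_sum; apply: eq_bigr => i _; rewrite mulr1.
rewrite spider_formS -IHc -!two_legs_sum !mulr_sumr -big_split -sumrB /=.
by apply: eq_bigr => i _; rewrite !leg_sumS; ring.
Qed.

(** * Elementary symmetric functions and the path recurrence *)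

Definition elem_sym (k : nat) : A :=
  \sum_(h : {set 'I_N} | #|h| == k) \prod_(i in h) x i.

Definition elem_sym_avoid (i : 'I_N) (k : nat) : A :=
  \sum_(h : {set 'I_N} | (#|h| == k) && (i \notin h)) \prod_(j in h) x j.

Lemma elem_sym_containS i k :
  \sum_(h : {set 'I_N} | (#|h| == k.+1) && (i \in h)) \prod_(j in h) x j
    = x i * elem_sym_avoid i k.
Proof.
rewrite mulr_sumr (reindex_onto (fun h => i |: h) (fun h => h :\ i)) /=; last first.
  by move=> h /andP[_ ih]; rewrite setD1K.
apply: eq_big => [h|h].
  rewrite setU11 andbT cardsU1; case: (boolP (i \in h)) => ih /=.
    rewrite !andbF; apply/negP => /andP[_ /eqP E].
    by move: ih; rewrite -E !inE eqxx.
  by rewrite setU1K // eqxx !andbT add1n.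
move=> /andP[_ /eqP E]; rewrite big_setU1 //.
by rewrite -E !inE eqxx.
Qed.

Lemma elem_sym_avoid0 i : elem_sym_avoid i 0 = 1.
Proof.
rewrite /elem_sym_avoid (big_pred1 set0) ?big_set0 // => h.
by rewrite cards_eq0 /=; case: eqP => // ->; rewrite inE.
Qed.

Lemma elem_sym0 : elem_sym 0 = 1.
Proof. by rewrite /elem_sym (big_pred1 set0) ?big_set0 // => h; rewrite cards_eq0. Qed.

Lemma elem_sym_avoidS i k : elem_sym k.+1 = elem_sym_avoid i k.+1 + x i * elem_sym_avoid i k.
Proof. by rewrite /elem_sym (bigID (fun h : {set 'I_N} => i \in h)) /= addrC elem_sym_containS. Qed.

(** Double counting: a set of size [k + 1] arises once from each of its elements. *)
Lemma newton_elem_sym_avoid k : \sum_i x i * elem_sym_avoid i k = k.+1%:R * elem_sym k.+1.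
Proof.
under eq_bigr do rewrite -elem_sym_containS.
rewrite (exchange_big_dep (fun h : {set 'I_N} => #|h| == k.+1)) => [|i h _ /andP[]] //=.
rewrite mulr_sumr; apply: eq_bigr => h /eqP hk.
by under eq_bigl do rewrite hk eqxx; rewrite sumr_const hk mulr_natl.
Qed.

(* Both sides are the coefficient of [z^m] in [E(z) P(z) / (1 + x_i z)]. *)
Lemma elem_sym_leg_conv i m :
  \sum_(s < m.+1) elem_sym s * leg_sum (m - s) i
    = \sum_(s < m.+1) elem_sym_avoid i s * path_sum (m - s).
Proof.
case: m => [|m]; first by rewrite !big_ord1 elem_sym0 elem_sym_avoid0.
have shift : leg_sum m.+1 i + \sum_(s < m.+1) elem_sym_avoid i s.+1 * leg_sum (m - s) i
    = \sum_(s < m.+1) elem_sym_avoid i s * leg_sum (m.+1 - s) i + elem_sym_avoid i m.+1.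
  transitivity (\sum_(s < m.+2) elem_sym_avoid i s * leg_sum (m.+1 - s) i).
    by rewrite [RHS]big_ord_recl /= elem_sym_avoid0 mul1r.
  by rewrite big_ord_recr /= subnn mulr1.
rewrite big_ord_recl [RHS]big_ord_recr /= subnn subn0 elem_sym0 mul1r mulr1.
under eq_bigr do rewrite /bump leq0n add1n subSS (elem_sym_avoidS i) mulrDl.
rewrite big_split /= addrA shift addrAC -big_split; congr (_ + _).
by apply: eq_bigr => s _; rewrite subSn -1?ltnS // leg_sumS /=; ring.
Qed.

(** Multiplying [elem_sym_leg_conv] by [x i] and summing over [i] gives
    [E(z) (P(z) - 1) = z E'(z) P(z)], that is [P = E / (E - z E')]. *)
Lemma path_sum_rec n :
  path_sum n.+1 = elem_sym n.+1 + \sum_(s < n.+1) s%:R * elem_sym s.+1 * path_sum (n - s).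
Proof.
have conv : \sum_(s < n.+1) elem_sym s * path_sum (n - s).+1
    = \sum_(s < n.+1) s.+1%:R * elem_sym s.+1 * path_sum (n - s).
  under [RHS]eq_bigr do rewrite -newton_elem_sym_avoid mulr_suml.
  under [LHS]eq_bigr do rewrite path_sumS mulr_sumr.
  rewrite exchange_big [RHS]exchange_big; apply: eq_bigr => i _ /=.
  under [RHS]eq_bigr do rewrite -mulrA.
  by rewrite -mulr_sumr -elem_sym_leg_conv mulr_sumr; apply: eq_bigr => s _; rewrite mulrCA.
(* Solve for [P_(n+1)], the term [s = 0] on the left; the other left terms lower each factor [s + 1]
   to [s]. *)
move: conv; rewrite big_ord_recl [in RHS]big_ord_recr /= subnn subn0 elem_sym0 mul1r mulr1.
move/(canRL (addrK _)) => ->; rewrite [in RHS]big_ord_recr /= subnn mulr1 addrAC -sumrB.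
rewrite addrC -natr1 mulrDl mul1r -addrA addrC -addrA; congr (_ + (_ + _)).
apply: eq_bigr => s _.
by rewrite /bump leq0n add1n -subSn ?subSS // -natr1; ring.
Qed.
End LegSums.

(** * Path functions as polynomials in the [e_j] *)

Fixpoint path_terms (A : comNzRingType) (e : nat -> A) (n : nat) : seq A :=
  if n is m.+1 then
    (e n + \sum_(s < n) s%:R * e s.+1 * (path_terms e m)`_s) :: path_terms e m
  else [:: 1].

(* Locked because otherwise [rewrite coefD] unfolds it through conversion. *)
Definition path_poly (A : comNzRingType) (e : nat -> A) (n : nat) : A :=
  locked (path_terms e n)`_0.

Section PathPolynomials.

Variable (A : comNzRingType).
Implicit Type (e P : nat -> A).

Lemma path_poly0 e : path_poly e 0 = 1.
Proof. by rewrite /path_poly -lock. Qed.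

Lemma path_polyS e n :
  path_poly e n.+1 = e n.+1 + \sum_(s < n.+1) s%:R * e s.+1 * path_poly e (n - s).
Proof.
have nth_terms m s : (s <= m)%N -> (path_terms e m)`_s = path_poly e (m - s).
  rewrite /path_poly -lock; elim: m s => [|m IHm] [|s] //=.
  by rewrite ltnS subSS => /IHm.
rewrite {1}/path_poly -lock /=; congr (_ + _); apply: eq_bigr => s _.
by rewrite nth_terms // -ltnS.
Qed.

Lemma path_poly_unique e P : P 0 = 1 ->
  (forall n, P n.+1 = e n.+1 + \sum_(s < n.+1) s%:R * e s.+1 * P (n - s)%N) ->
  P =1 path_poly e.
Proof.
move=> P0 PS; elim/ltn_ind => -[|n] IHn; first by rewrite P0 path_poly0.
rewrite PS path_polyS; congr (_ + _); apply: eq_bigr => s _.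
by rewrite IHn // ltnS leq_subr.
Qed.

(** The recurrence reads [e] at positive indices only, which absorbs the junk value of [esym_var] at
    0. *)
Lemma eq_path_poly e e' : (forall n, e n.+1 = e' n.+1) -> path_poly e =1 path_poly e'.
Proof.
move=> ee'; apply: path_poly_unique => [|n]; first exact: path_poly0.
rewrite path_polyS ee'.
by congr (_ + _); apply: eq_bigr => s _; rewrite ee'.
Qed.

Lemma eq_spider_form P P' : P =1 P' -> forall a b c, spider_form P a b c = spider_form P' a b c.
Proof.
move=> PP' a b c; elim: c b => [|c IHc] b; first exact: PP'.
by rewrite !spider_formS IHc !PP'.
Qed.

End PathPolynomials.

Lemma rmorph_path_poly (A B : comNzRingType) (f : {rmorphism A -> B}) e n :
  f (path_poly e n) = path_poly (f \o e) n.
Proof.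
move: n; change (f \o path_poly e =1 path_poly (f \o e)).
apply: path_poly_unique => [|m] /=.
  by rewrite path_poly0 rmorph1.
rewrite path_polyS rmorphD rmorph_sum; congr (_ + _); apply: eq_bigr => s _ /=.
by rewrite !rmorphM rmorph_nat.
Qed.

Lemma rmorph_spider_form (A B : comNzRingType) (f : {rmorphism A -> B}) P a b c :
  f (spider_form P a b c) = spider_form (f \o P) a b c.
Proof. by elim: c b => [|c IHc] b //; rewrite !spider_formS rmorphB rmorphD IHc !rmorphM. Qed.

(** * Substituting values for the elementary symmetric functions *)

Section Specialization.
Variable N : nat.

(* The preimage of [e_k] for [1 <= k <= N]; [0] for [k > N], and a junk value at [k = 0]. *)
Definition esym_var (k : nat) : {mpoly int[N]} :=
  if (insub k.-1 : option 'I_N) is Some i then 'X_i else 0.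

Local Notation S := [tuple mesym N int i.+1 | i < N].

Lemma esym_var_comp k : esym_var k.+1 \mPo S = mesym N int k.+1.
Proof.
rewrite /esym_var /=; case: insubP => [i _ <- | kN].
  by rewrite comp_mpolyXU -tnth_nth tnth_mktuple.
rewrite raddf0 /mesym big_pred0 // => h; apply/negP => /eqP hk.
by have := max_card (mem h); rewrite hk card_ord; apply/negP.
Qed.

(** Algebraic independence lifts the positive expansion to an identity in free variables for
    [e_1, ..., e_N], where any values may be substituted. [K] serves as the cone of nonnegative
    elements. *)
Lemma specialize_e_positive (A : comNzRingType) (K : semiringClosed A) (v : nat -> A) d a b c :
  (forall k, v k \in K) -> (forall k, (N < k)%N -> v k = 0) ->
  e_positive_poly d (spider_form (path_sum (fun i : 'I_N => 'X_i : {mpoly int[N]})) a b c) ->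
  spider_form (path_poly v) a b c \in K.
Proof.
move=> vK v0 [s [/allP s_part]].
pose spec : {rmorphism {mpoly int[N]} -> A} :=
  mmap (intmul 1 : int -> A) (fun i : 'I_N => v i.+1).
have spec_var k : spec (esym_var k.+1) = v k.+1.
  rewrite /esym_var /=; case: insubP => [i _ <- | kN].
    by rewrite /= mmapX mmap1U.
  by rewrite rmorph0 v0 // ltnS leqNgt.
set X := spider_form _ a b c => X_pos.
have XE : X = spider_form (path_poly esym_var) a b c \mPo S.
  rewrite (rmorph_spider_form (comp_mpoly S)); apply: eq_spider_form => n.
  rewrite /= (rmorph_path_poly (comp_mpoly S)).
  rewrite (path_poly_unique (e := mesym N int) (P := path_sum _)) => [|//|m].
    by apply: eq_path_poly => m; rewrite /= esym_var_comp.
  exact: path_sum_rec.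
have {X_pos} : spider_form (path_poly esym_var) a b c
    = \sum_(p <- s) p.1%:R * \prod_(k <- p.2) esym_var k.
  apply: (@msym_fundamental_un N int); rewrite -XE X_pos rmorph_sum.
  rewrite !big_seq; apply: eq_bigr => p /s_part /andP[_ /allP p_pos].
  rewrite rmorphM rmorph_nat rmorph_prod /e_prod !big_seq; congr (_ * _).
  by apply: eq_bigr => -[|k] /p_pos // _; exact/esym/esym_var_comp.
move/(congr1 spec); rewrite rmorph_spider_form.
rewrite (eq_spider_form (P' := path_poly v)) => [->|n /=]; last first.
  by rewrite rmorph_path_poly; apply: eq_path_poly => m /=; rewrite spec_var.
rewrite rmorph_sum big_seq rpred_sum // => p /s_part /andP[_ /allP p_pos].
rewrite rmorphM rmorph_nat rmorph_prod rpredM ?rpred_nat // big_seq rpred_prod //.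
by move=> -[|k] /p_pos // _; rewrite spec_var.
Qed.

End Specialization.

(** * Colorings as words *)

Section Words.
Variables (A : comNzRingType) (N : nat).
Implicit Types (m : nat) (F G : seq 'I_N -> A).

(** Nested sums, so that concatenating the legs splits the sum over colorings into one sum per
    leg. *)
Fixpoint word_sum m F : A :=
  if m is m'.+1 then \sum_j word_sum m' (fun w => F (j :: w)) else F [::].

Lemma eq_word_sum m F G :
  (forall w, size w = m -> F w = G w) -> word_sum m F = word_sum m G.
Proof.
elim: m F G => [|m IHm] F G FG /=; first exact: FG.
by apply: eq_bigr => j _; apply: IHm => w wm; apply: FG; rewrite /= wm.
Qed.

Lemma word_sum_cat m k F :
  word_sum (m + k) F = word_sum m (fun u => word_sum k (fun v => F (u ++ v))).
Proof. by elim: m F => [|m IHm] F //=; apply: eq_bigr => j _; rewrite IHm. Qed.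

Lemma word_sumMl m r F : word_sum m (fun w => r * F w) = r * word_sum m F.
Proof.
elim: m F => [|m IHm] F //=; rewrite mulr_sumr.
by apply: eq_bigr => j _; rewrite -IHm.
Qed.

Lemma word_sumMr m r F : word_sum m (fun w => F w * r) = word_sum m F * r.
Proof.
rewrite mulrC -word_sumMl; apply: eq_word_sum => w _; exact: mulrC.
Qed.

Lemma sum_codom m F : \sum_(k : {ffun 'I_m -> 'I_N}) F (codom k) = word_sum m F.
Proof.
elim: m F => [|m IHm] F /=.
  rewrite (big_pred1 (ffun0 (card_ord 0))) => [|k].
    by congr F; apply: size0nil; rewrite size_codom card_ord.
  by apply/esym/eqP/ffunP => -[].
pose ext (p : 'I_N * {ffun 'I_m -> 'I_N}) : {ffun 'I_m.+1 -> 'I_N} :=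
  [ffun i => if unlift ord0 i is Some j then p.2 j else p.1].
under [RHS]eq_bigr do rewrite -IHm.
rewrite pair_big /= (reindex ext).
  apply: eq_bigr => -[c k] _; congr F.
  rewrite !codomE enum_ordSl /= ffunE unlift_none -map_comp; congr cons.
  by apply: eq_map => i /=; rewrite ffunE liftK.
exists (fun k : {ffun 'I_m.+1 -> 'I_N} => (k ord0, [ffun j : 'I_m => k (lift ord0 j)]))
  => [[c k] _ | k _] /=.
  rewrite /ext ffunE unlift_none; congr pair.
  by apply/ffunP => j; rewrite !ffunE liftK.
apply/ffunP => i; rewrite ffunE.
by case: unliftP => [j|] -> //=; rewrite ffunE.
Qed.

Variable x : 'I_N -> A.

Definition leg_weight (i : 'I_N) (w : seq 'I_N) : A :=
  if path (fun j k => j != k) i w then \prod_(j <- w) x j else 0.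

Lemma word_sum_leg m i : word_sum m (leg_weight i) = leg_sum x m i.
Proof.
elim: m i => [|m IHm] i; first by rewrite /= /leg_weight big_nil.
rewrite /= -[RHS]/(\sum_(j | j != i) x j * leg_sum x m j) [RHS]big_mkcond.
apply: eq_bigr => j _; rewrite -IHm -word_sumMl; case: eqVneq => [->|ji] /=.
  (* Zero is written [0 * 0] so that [word_sumMl] can pull out a zero factor. *)
  rewrite (eq_word_sum (G := fun w => 0 * 0)) ?(word_sumMl _ _ (fun=> 0)) ?mul0r // => w _.
  by rewrite /leg_weight /= eqxx.
apply: eq_word_sum => w _; rewrite /leg_weight /= eq_sym ji /= big_cons.
by case: path; rewrite ?mulr0.
Qed.

End Words.

(** * Proper colorings of the spider *)

Section SpiderColorings.

(* The edges of the leg with vertices [o+1, ..., o+l], whose first vertex is joined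
   to the center [0]. *)
Definition leg_edge (o l x y : nat) : bool :=
  [&& (o < y)%N, (y <= o + l)%N & x == if y == o.+1 then 0%N else y.-1].

Lemma spider_step_legs a b c x y : (0 < a)%N -> (0 < b)%N -> (0 < c)%N ->
  spider_step a b c x y = [|| leg_edge 0 a x y, leg_edge a b x y | leg_edge (a + b) c x y].
Proof.
move=> a0 b0 c0; rewrite /spider_step /leg_edge.
do 3![case: ifP => ?]; lia.
Qed.

(** Here [s] lists all colors, center first, and [t] is its block for one leg; the edge into vertex
    [o + j + 1] is step [j] of the path from [i] along [t]. *)
Lemma leg_properP (T : eqType) (i : T) (s t : seq T) (o : nat) :
  nth i s 0 = i -> (forall j, (j < size t)%N -> nth i s (o + j).+1 = nth i t j) ->
  reflect (forall x y, leg_edge o (size t) x y -> nth i s x != nth i s y)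
          (path (fun j k => j != k) i t).
Proof.
move=> s0 st; apply: (iffP (pathP i)) => [t_path x y /and3P[oy yl /eqP->] | s_proper j jt].
  have yE : y = (o + (y - o.+1)).+1 by lia.
  have jt : (y - o.+1 < size t)%N by lia.
  have := t_path _ jt; rewrite -st // -yE.
  case: (y =P o.+1) => [yo|yo]; first by rewrite {1}yo subnn s0.
  have -> : (y - o.+1 = (y - o.+2).+1)%N by lia.
  rewrite /= -st; last lia.
  by have -> : ((o + (y - o.+2)).+1 = y.-1)%N by lia.
rewrite -st //; case: j jt => [|j] jt /=.
  by rewrite -{1}s0; apply: s_proper; rewrite /leg_edge; case: ifP; lia.
rewrite -st; last exact: ltnW.
by apply: s_proper; rewrite /leg_edge; case: ifP; lia.
Qed.

Lemma spider_proper (T : eqType) (i : T) (u v w : seq T) :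
  let a := size u in let b := size v in let c := size w in
  (0 < a)%N -> (0 < b)%N -> (0 < c)%N ->
  [forall x : 'I_(a + b + c + 1), forall y : 'I_(a + b + c + 1),
     spider_adj x y ==> (nth i (i :: u ++ v ++ w) x != nth i (i :: u ++ v ++ w) y)]
  = [&& path (fun j k => j != k) i u, path (fun j k => j != k) i v
      & path (fun j k => j != k) i w].
Proof.
move=> a b c a0 b0 c0; set s := i :: _.
have u_nth j : (j < a)%N -> nth i s (0 + j).+1 = nth i u j.
  by move=> ja; rewrite /s /= nth_cat ja.
have v_nth j : (j < b)%N -> nth i s (a + j).+1 = nth i v j.
  by move=> jb; rewrite /s /= nth_cat ltnNge leq_addr addKn nth_cat jb.
have w_nth j : (j < c)%N -> nth i s (a + b + j).+1 = nth i w j.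
  by move=> _; rewrite /s -addnA /= nth_cat ltnNge leq_addr addKn nth_cat ltnNge leq_addr addKn.
have uP := leg_properP (erefl : nth i s 0 = i) u_nth.
have vP := leg_properP (erefl : nth i s 0 = i) v_nth.
have wP := leg_properP (erefl : nth i s 0 = i) w_nth.
apply/forallP/and3P => [proper | [/uP u_proper /vP v_proper /wP w_proper] x].
  have step x y : spider_step a b c x y -> nth i s x != nth i s y.
    move=> xy; have := xy; rewrite spider_step_legs // /leg_edge => bounds.
    have xn : (x < a + b + c + 1)%N by move: bounds; do 3![case: ifP => _]; lia.
    have yn : (y < a + b + c + 1)%N by move: bounds; do 3![case: ifP => _]; lia.
    have /forallP/(_ (Ordinal yn))/implyP := proper (Ordinal xn).
    by apply; rewrite /spider_adj /= xy.
  by split; [apply/uP | apply/vP | apply/wP] => x y xy; apply: step;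
     rewrite spider_step_legs // xy ?orbT.
have step z y : spider_step a b c z y -> nth i s z != nth i s y.
  by rewrite spider_step_legs // => /or3P[/u_proper|/v_proper|/w_proper].
by apply/forallP => y; apply/implyP => /orP[] /step //; rewrite eq_sym.
Qed.

Lemma chrom_sym_spider (N a b c : nat) : (0 < a)%N -> (0 < b)%N -> (0 < c)%N ->
  chrom_sym N (@spider_adj a b c)
    = spider_form (path_sum (fun i : 'I_N => 'X_i : {mpoly int[N]})) a b c.
Proof.
move=> a0 b0 c0; rewrite -three_legs_sum /chrom_sym.
case: N => [|N].
  by rewrite big_ord0 big_pred0 // => k; case: (k (Ordinal (_ : (0 < a + b + c + 1)%N))); lia.
pose X (i : 'I_N.+1) : {mpoly int[N.+1]} := 'X_i.
(* The default of [nth] is the head of the word, the center's color, as [spider_proper] expects. *)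
pose F (w : seq 'I_N.+1) : {mpoly int[N.+1]} :=
  if [forall x : 'I_(a + b + c + 1), forall y : 'I_(a + b + c + 1),
     spider_adj x y ==> (nth (head ord0 w) w x != nth (head ord0 w) w y)]
  then \prod_(j <- w) X j else 0.
transitivity (word_sum (a + b + c + 1) F).
  have nth_codom (k : {ffun 'I_(a + b + c + 1) -> 'I_N.+1}) (x : 'I_(a + b + c + 1)) :
      nth (head ord0 (codom k)) (codom k) x = k x.
    by rewrite (nth_map x) ?size_enum_ord ?nth_ord_enum.
  rewrite -sum_codom big_mkcond; apply: eq_bigr => k _; rewrite /F [in RHS]big_map big_enum.
  congr (if _ then _ else _); apply: eq_forallb => x; apply: eq_forallb => y.
  by rewrite !nth_codom.
(* The first letter colors the center; the rest is cut into the legs [u], [v], [w]. *)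
rewrite addn1 -addnA /=; apply: eq_bigr => i _.
rewrite word_sum_cat -!word_sum_leg -/X -mulrA -(word_sumMr _ (word_sum b _ * _)) -word_sumMl.
apply: eq_word_sum => u ua; rewrite word_sum_cat -word_sumMr -!word_sumMl.
apply: eq_word_sum => v vb; rewrite -!word_sumMl; apply: eq_word_sum => w wc.
subst a b c; rewrite /F [head _ _]/= spider_proper // /leg_weight big_cons !big_cat.
by do 3!case: path => /=; rewrite ?(mulr0, mul0r).
Qed.

End SpiderColorings.

(** * Substitutions supported on two consecutive indices *)

Definition consecutive_values (A : comNzRingType) (k : nat) (t : A) (j : nat) : A :=
  if j == k then 1 else if j == k.+1 then t else 0.

Lemma path_poly_consecutive (A : comNzRingType) (h : nat) (t : A) (n : nat) :
  let v := consecutive_values h.+1 t in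
  path_poly v n.+1 = v n.+1 + (if (h <= n)%N then h%:R * path_poly v (n - h) else 0)
    + (if (h < n)%N then h.+1%:R * t * path_poly v (n - h.+1) else 0).
Proof.
move=> v; rewrite path_polyS -addrA; congr (_ + _).
rewrite -[(h <= n)%N]ltnS -[(h < n)%N]ltnS.
(* Each conditional term becomes a one-point sum over [s], so that both sides compare termwise. *)
rewrite -(big_ord1_eq +%R (fun s => h%:R * path_poly v (n - s)) h).
rewrite -(big_ord1_eq +%R (fun s => h.+1%:R * t * path_poly v (n - s)) h.+1).
rewrite !(big_mkcond (fun s : 'I_n.+1 => _ == _ :> nat)) -big_split /=.
apply: eq_bigr => s _; rewrite /v /consecutive_values !eqSS.
case: (eqVneq (s : nat) h) => [->|_]; first by rewrite (ltn_eqF (ltnSn h)) mulr1 addr0.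
by case: eqVneq => [->|_]; rewrite ?mulr0 ?mul0r add0r.
Qed.

Lemma coef1M (R : nzRingType) (p q : {poly R}) : (p * q)`_1 = p`_0 * q`_1 + p`_1 * q`_0.
Proof. by rewrite coefM big_ord_recl big_ord1. Qed.

(* Coefficient [1] in ['X] extracts the monomials with exactly one factor [e_3]. *)
Section TwoThree.

Local Notation P := (path_poly (consecutive_values 2 ('X : {poly int}))).

Lemma path_poly23_rec n : P n.+4 = P n.+2 + ('X * P n.+1) *+ 2.
Proof.
rewrite path_poly_consecutive /= !subSS !subn0 /consecutive_values /=.
by rewrite add0r mul1r -mulrA mulr_natl.
Qed.

Lemma path_poly23_init : [/\ P 1 = 0, P 2 = 2%:R & P 3 = 'X *+ 3].
Proof.
have P1 : P 1 = 0 by rewrite path_poly_consecutive /= /consecutive_values /= !addr0.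
split=> //; rewrite path_poly_consecutive /= !subSS ?subn0 path_poly0 /consecutive_values /=.
  by rewrite addr0 mul1r.
by rewrite P1; ring.
Qed.

(** For odd [n], coefficient 1 starts at 3 for [P 3], and each step by two adds [2 * 2]; [P 1 = 0]
    is off this line. *)
Lemma path_poly23_coef n : (0 < n)%N ->
  (P n)`_0 = (~~ odd n)%:R * 2%:R /\
  (odd n -> (P n)`_1 = if n == 1%N then 0 else 2%:R * n%:R - 3%:R).
Proof.
have [P1 P2 P3] := path_poly23_init.
elim/ltn_ind: n => -[|[|[|[|n]]]] IHn // _.
- by rewrite P1 !coef0 mul0r.
- by rewrite P2 -polyC_natr coefC mul1r.
- by rewrite P3 !coefMn !coefX mul0r.
have [IH0 IH1] := IHn n.+2 (leqnSn _) isT; have [IH0' _] := IHn n.+1 (leqW (leqnSn _)) isT.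
have X0 (p : {poly int}) : ('X * p)`_0 = 0 by rewrite coefXM.
have X1 (p : {poly int}) : ('X * p)`_1 = p`_0 by rewrite coefXM.
split=> [|on]; rewrite path_poly23_rec !coefD ?X0 ?X1.
  by rewrite IH0 !addr0 !oddS !negbK.
have on2 : odd n.+2 by move: on; rewrite !oddS !negbK.
rewrite (IH1 on2) IH0'; move: on; rewrite !oddS !negbK => -> /=; lia.
Qed.

Lemma P23_coef0_even n : ~~ odd n -> (0 < n)%N -> (P n)`_0 = 2%:R.
Proof. by move=> en n0; have [-> _] := path_poly23_coef n0; rewrite en mul1r. Qed.

Lemma P23_coef0_odd n : odd n -> (P n)`_0 = 0.
Proof. by move=> on; have [-> _] := path_poly23_coef (odd_gt0 on); rewrite on mul0r. Qed.

Lemma P23_coef1_odd n : odd n -> (1 < n)%N -> (P n)`_1 = 2%:R * n%:R - 3%:R.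
Proof. by move=> on n1; have [_ ->] := path_poly23_coef (ltnW n1); rewrite // gtn_eqF. Qed.

(** At [c = 1] the value is [2 - 2 * 2]. Moving two vertices from C to B adds and subtracts one
    product [2 * 2] of even paths. *)
Lemma spider_form23_coef0 a b c : odd a -> odd b -> odd c ->
  (spider_form P a b c)`_0 = - 2%:R.
Proof.
move=> oa ob; have [P1 _ _] := path_poly23_init.
have ea1 : ~~ odd a.+1 by rewrite oddS oa.
elim/ltn_ind: c b ob => -[|[|c]] IHc b ob // oc; rewrite !spider_formS !(coefB, coefD, coef0M).
  have eab : ~~ odd (a + b.+1).+1 by rewrite oddS oddD oa oddS ob.
  have eb1 : ~~ odd b.+1 by rewrite oddS ob.
  rewrite [spider_form P a b.+1 0]/= addn0 P1 coef0 mul0r addr0.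
  by rewrite (P23_coef0_even eab) // (P23_coef0_even ea1) // (P23_coef0_even eb1).
move: oc; rewrite !oddS negbK => oc.
have eab : ~~ odd (a + b.+1).+1 by rewrite oddS oddD oa oddS ob.
have oab : odd (a + b).+1 by rewrite oddS oddD oa ob.
have oac : odd (a + c).+1 by rewrite oddS oddD oa oc.
have eac : ~~ odd (a + c.+1).+1 by rewrite oddS oddD oa oddS oc.
have ec1 : ~~ odd c.+1 by rewrite oddS oc.
have eb1 : ~~ odd b.+1 by rewrite oddS ob.
have ob2 : odd b.+2 by rewrite !oddS ob.
rewrite IHc // (P23_coef0_odd oab) (P23_coef0_odd oac) (P23_coef0_even eab) //
  (P23_coef0_even eac) //.
by rewrite (P23_coef0_even ec1) // (P23_coef0_even eb1) // !mulr0 subr0 addr0.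
Qed.

(** The case [c = 1] is direct; moving two vertices from C to B keeps [b + c], and the four
    corrections cancel. *)
Lemma spider_form23_coef1 a b c : ~~ odd a -> (0 < a)%N -> odd b -> odd c ->
  (spider_form P a b c)`_1 = 1 - 2%:R * (a%:R - b%:R - c%:R).
Proof.
move=> ea a0 ob; have [P1 _ _] := path_poly23_init.
have oa1 : odd a.+1 by [].
have gt1 m : (1 < (a + m.+1).+1)%N by rewrite addnS.
elim/ltn_ind: c b ob => -[|[|c]] IHc b ob // oc; rewrite !spider_formS !(coefB, coefD, coef1M).
  have oab : odd (a + b.+1).+1 by rewrite !oddS oddD oddS (negbTE ea) ob.
  have eb1 : ~~ odd b.+1 by rewrite oddS ob.
  rewrite [spider_form P a b.+1 0]/= addn0 P1 !coef0 !mul0r !addr0.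
  rewrite (P23_coef1_odd oa1) // (P23_coef1_odd oab (gt1 _)) (P23_coef0_odd oa1)
    (P23_coef0_even eb1) //.
  by rewrite mulr0 -!natr1 natrD -natr1; ring.
move: oc; rewrite !oddS negbK => oc.
have oab : odd (a + b.+1).+1 by rewrite !oddS oddD oddS (negbTE ea) ob.
have oac : odd (a + c.+1).+1 by rewrite !oddS oddD oddS (negbTE ea) oc.
have eab : ~~ odd (a + b).+1 by rewrite oddS oddD (negbTE ea) ob.
have eac : ~~ odd (a + c).+1 by rewrite oddS oddD (negbTE ea) oc.
have oc2 : odd c.+2 by rewrite !oddS oc.
have ob2 : odd b.+2 by rewrite !oddS ob.
have ec1 : ~~ odd c.+1 by rewrite oddS oc.
have eb1 : ~~ odd b.+1 by rewrite oddS ob.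
rewrite IHc //.
rewrite (P23_coef1_odd oc2) // (P23_coef1_odd oac (gt1 _)) (P23_coef1_odd oab (gt1 _))
  (P23_coef1_odd ob2) //.
rewrite (P23_coef0_odd oc2) (P23_coef0_odd oac) (P23_coef0_odd oab) (P23_coef0_odd ob2).
rewrite (P23_coef0_even ec1) // (P23_coef0_even eac) // (P23_coef0_even eab) //
  (P23_coef0_even eb1) //.
rewrite !mulr0 !mul0r -!natr1 !natrD -!natr1; ring.
Qed.

End TwoThree.

(** * The substitution [e_k = e_(k+1) = 1] with [k = h + 1] *)

Section Balanced.
Variable h : nat.
Hypothesis h_gt0 : (0 < h)%N.

Local Notation P := (path_poly (consecutive_values h.+1 (1 : int))).

Lemma path_poly_balanced n : (0 < n < h.*2.+2)%N ->
  P n = if n == h.+1 then h.+1%:R else if n == h.+2 then h.+2%:R else 0.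
Proof.
elim/ltn_ind: n => -[|n] IHn // n_lt; rewrite path_poly_consecutive mulr1.
(* The recurrence reaches back only to indices at most [h], where just [P 0 = 1] is nonzero. *)
have P_tail m : (h <= m <= n)%N -> P (n - m) = (n == m)%:R.
  move=> mn; case: eqP => [->|nm]; first by rewrite subnn path_poly0.
  by rewrite IHn; [do 2![case: eqP => [?|_]; first lia] | lia | lia].
rewrite {1}/consecutive_values !eqSS.
case: (ltngtP n h) => [nh|nh|->].
- by rewrite !addr0; case: eqP => // ?; lia.
- rewrite !P_tail; [|lia..]; rewrite (gtn_eqF nh) mulr0 addr0.
  by case: eqP => _; rewrite ?mulr1 ?mulr0n ?mulr0 ?addr0 ?nat1r.
by rewrite subnn path_poly0 mulr1 addr0 nat1r.
Qed.

Lemma path_poly_balanced_top : P h.*2.+3 = 2%:R * h.+1%:R ^+ 2 - 1.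
Proof.
rewrite path_poly_consecutive {1}/consecutive_values mulr1.
do 2![case: eqP => [?|_]; first lia].
rewrite !ifT; [|lia..].
have -> : (h.*2.+2 - h = h.+2)%N by lia.
have -> : (h.*2.+2 - h.+1 = h.+1)%N by lia.
rewrite !path_poly_balanced ?eqxx; [|lia..].
by rewrite gtn_eqF // -[h.+2%:R]natr1 -natr1; ring.
Qed.

(** The indices of [P b.+1 * P (a + c).+1] sum to [2 h + 3], so it is nonzero only for the pair
    [h + 1], [h + 2]. The booleans record which of [b = h], [b = h + 1] are met as C moves onto
    B. *)
Lemma spider_form_balanced a b c : (0 < a <= h)%N -> (c <= h)%N -> (a + b + c = h.*2.+2)%N ->
  spider_form P a b c = 2%:R * h.+1%:R ^+ 2 - 1
    - h.+1%:R * h.+2%:R * ((b <= h)%N%:R + (b <= h.+1)%N%:R).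
Proof.
elim: c b => [|c IHc] b a_le c_le abc.
  have [-> -> abE] : [/\ (b <= h)%N = false, (b <= h.+1)%N = false & (a + b).+1 = h.*2.+3].
    by split; lia.
  by rewrite /= abE path_poly_balanced_top addr0 mulr0 subr0.
have Pc : P c.+1 = 0.
  by rewrite path_poly_balanced; [do 2![case: eqP => [?|_]; first lia] | lia].
have Pb : P b.+1 * P (a + c).+1 = h.+1%:R * h.+2%:R * ((b == h)%:R + (b == h.+1)%:R).
  rewrite !path_poly_balanced; [|lia..]; rewrite !eqSS.
  case: (b =P h) => [bh|bh].
    have -> : (a + c == h)%N = false by lia.
    have -> : (a + c == h.+1)%N by lia.
    by rewrite bh (ltn_eqF (ltnSn h)) addr0 mulr1.
  case: (b =P h.+1) => [bh1|bh1]; last by rewrite mul0r addr0 mulr0.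
  have -> : (a + c == h)%N by lia.
  by rewrite add0r mulr1 mulrC.
rewrite spider_formS IHc; [|lia..].
rewrite Pc Pb mul0r addr0.
have -> : (b <= h)%N%:R + (b <= h.+1)%N%:R
    = (b < h)%N%:R + (b < h.+1)%N%:R + ((b == h)%:R + (b == h.+1)%:R) :> int.
  by rewrite addrACA; congr (_ + _); case: ltngtP.
by rewrite [in RHS]mulrDr opprD addrA.
Qed.

End Balanced.

(** * The three cases *)

Theorem theorem3p1 (a b c : nat) :
  (b <= a)%N -> (c <= b)%N -> (1 <= c)%N -> odd b -> odd c ->
  spider_e_positive a b c -> a = (b + c)%N.
Proof.
move=> ba cb c0 ob oc; rewrite /spider_e_positive /e_positive_graph.
have b0 : (0 < b)%N by exact: leq_trans cb.
have a0 : (0 < a)%N by exact: leq_trans ba.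
rewrite chrom_sym_spider // => epos.
(* By parity the gap is at least 2, which later yields [a <= h]. *)
have oabc : ~~ odd a -> a != (b + c)%N -> ((b + c).+2 <= a)%N \/ (a.+2 <= b + c)%N by lia.
have coef_ge0 i : 0 <= (spider_form (path_poly (consecutive_values 2 ('X : {poly int}))) a b c)`_i.
  (* The cone is that of polynomials with nonnegative coefficients. *)
  rewrite -nnegrE; apply/polyOverP: i; apply: (specialize_e_positive _ _ epos) => k.
    rewrite /consecutive_values.
    by case: eqP => _; [exact: rpred1 | case: eqP => _; [exact: polyOverX | exact: rpred0]].
  by rewrite /consecutive_values => kN; do 2![case: eqP => [?|_]; first lia].
apply/eqP; apply: contraT => abc.
case: (boolP (odd a)) => oa; first by have := coef_ge0 0; rewrite spider_form23_coef0.
case: (oabc oa abc) => abc'.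
  have := coef_ge0 1; rewrite spider_form23_coef1 //; lia.
have hE : (a + b + c = ((a + b + c)./2.-1).*2.+2)%N by lia.
set h := (a + b + c)./2.-1 in hE.
have : spider_form (path_poly (consecutive_values h.+1 (1 : int))) a b c \is Num.nneg.
  apply: (specialize_e_positive _ _ epos) => k; rewrite /consecutive_values.
    by case: ifP => // _; case: ifP.
  by move=> kN; do 2![case: eqP => [?|_]; first lia].
have [bh bh1 ah] : [/\ (b <= h)%N, (b <= h.+1)%N & (0 < a <= h)%N] by split; lia.
rewrite nnegrE spider_form_balanced ?bh ?bh1 //; [|lia..].
(* Both [b <= h] and [b <= h.+1] hold, so the full correction is subtracted and the value is
   negative. *)
have -> : 2%:R * h.+1%:R ^+ 2 - 1 - h.+1%:R * h.+2%:R * (1 + 1) = - 1 - 2%:R * h.+1%:R :> int.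
  by rewrite -[h.+2%:R]natr1; ring.
lia.
Qed.
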